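(* Let $n, b$ be positive integers, $d = nb$, and let $X \in \mathbb{R}^d$. Let $\mathcal{Z}(b;X) = \max_{j \in [n]} \sqrt{b} \; \delta_{\{j\}} \Vert X_{\{j\}} \Vert_\infty$, where $X_{\{j\}} \in \mathbb{R}^b$ is the $j$-th block of $X$ (with block size $b$) and $\delta_{\{j\}} = \Vert X_{\{j\}} \Vert_1 / \left( b \Vert X_{\{j\}} \Vert_\infty \right)$. Then, for all positive integers $k, b'$ such that $b = kb'$, $$\mathcal{Z}(b;X) \leq \sqrt{k} \; \mathcal{Z}(b';X),$$ where $\mathcal{Z}(b';X)$ is defined in the same way using the partition of $X$ into $d/b' = nk$ blocks of size $b'$.
   Context: $[n] = \{1,\dots,n\}$. For a positive integer $c$ dividing $d$, $X = (X_1,\dots,X_d)$ is partitioned into $d/c$ blocks of $c$ consecutive coordinates, the $j$-th block with block size $c$ being $X_{\{j\}} = (X_{(j-1)c+1}, \dots, X_{jc}) \in \mathbb{R}^c$ for $j \in [d/c]$, and $\mathcal{Z}(c;X) = \max_{j \in [d/c]} \sqrt{c}\, \delta_{\{j\}} \Vert X_{\{j\}} \Vert_\infty$ with $\delta_{\{j\}} = \Vert X_{\{j\}} \Vert_1 / (c \Vert X_{\{j\}} \Vert_\infty)$. Here $\Vert\cdot\Vert_1$ and $\Vert\cdot\Vert_\infty$ are the usual vector norms. Convention: if $X_{\{j\}} = 0$, the ratio $\delta_{\{j\}}$ is taken to be $0$. *)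

(* Defs.v *)
From HB Require Import structures.
From mathcomp Require Import all_boot all_order all_algebra.
From mathcomp Require Import reals normedtype.

Set Implicit Arguments.
Unset Strict Implicit.
Unset Printing Implicit Defensive.

Import Order.TTheory GRing.Theory Num.Theory.
Import numFieldNormedType.Exports.

Local Open Scope ring_scope.

Lemma block_index_subproof (d c : nat) (j : 'I_(d %/ c)) (i : 'I_c) :
  (j * c + i < d)%N.
Proof.
apply: leq_trans (leq_divM d c).
apply: leq_trans (_ : j.+1 * c <= _)%N; last by rewrite leq_mul2r ltn_ord orbT.
by rewrite mulSn addnC ltn_add2r.
Qed.

Definition block_index (d c : nat) (j : 'I_(d %/ c)) (i : 'I_c) : 'I_d :=
  Ordinal (block_index_subproof j i).

(* Blocks and coordinates are numbered from 0. The blocks cover all the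
   coordinates exactly when c divides d, which is the only intended use. *)
Definition block (R : realType) (d c : nat) (X : 'rV[R]_d) (j : 'I_(d %/ c)) :
  'rV[R]_c := \row_i X 0 (block_index j i).

Definition norm1 (R : realType) (c : nat) (x : 'rV[R]_c) : R :=
  \sum_(i < c) `|x 0 i|.

(* The norm `|x| of a row vector is its sup norm (mx_norm). If x = 0 the
   quotient is 0, since 0^-1 = 0. *)
Definition delta (R : realType) (c : nat) (x : 'rV[R]_c) : R :=
  norm1 x / (c%:R * `|x|).

(* Starting the maximum from 0 is harmless: every term is nonnegative. *)
Definition Z (R : realType) (d c : nat) (X : 'rV[R]_d) : R :=
  \big[Num.max/0]_(j < d %/ c)
    (Num.sqrt c%:R * delta (block X j) * `|block X j|).

(* Main.v *)
(** Each term of the maximum is the l^1 norm of a block divided by the square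
    root of its size. A block of size k b' is the union of k blocks of size b',
    so its l^1 norm is at most k times the largest of theirs, and
    k / sqrt (k b') = sqrt k / sqrt b'. *)

Require Import Defs.
From mathcomp Require Import all_boot all_order all_algebra.
From mathcomp Require Import reals normedtype.

Import Order.TTheory GRing.Theory Num.Theory.

Local Open Scope ring_scope.

Lemma sqrt_delta_normE (R : realType) (c : nat) (x : 'rV[R]_c) :
  (0 < c)%N ->
  Num.sqrt c%:R * delta x * `|x| = norm1 x / Num.sqrt c%:R.
Proof.
move=> c_gt0.
have sc_neq0 : Num.sqrt c%:R != 0 :> R by rewrite sqrtr_eq0 -ltNge ltr0n.
have [-> | x_neq0] := eqVneq x 0.
  rewrite normr0 mulr0 /norm1 big1 ?mul0r // => i _.
  by rewrite mxE normr0.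
rewrite /delta invfM !mulrA mulfVK ?normr_eq0 //.
(* The denominator [c] is split as the square of its root; one factor cancels the leading root. *)
rewrite -[in X in _ / X](@sqr_sqrtr R c%:R) ?ler0n // expr2 invfM mulrA.
by rewrite (mulrC (Num.sqrt _) (norm1 x)) mulfK.
Qed.

Lemma norm1_block_le (R : realType) (d c : nat) (X : 'rV[R]_d)
    (j : 'I_(d %/ c)) :
  (0 < c)%N -> norm1 (block X j) <= Num.sqrt c%:R * Z c X.
Proof.
move=> c_gt0; rewrite mulrC -ler_pdivrMr ?sqrtr_gt0 ?ltr0n //.
rewrite -sqrt_delta_normE //.
exact: (le_bigmax _ (fun i => Num.sqrt c%:R * delta (block X i) * `|block X i|)).
Qed.

(** Induction on [k], splitting off the last [c] indices. *)
Lemma sum_blocks_le (R : realType) (k c : nat) (F : nat -> R) (M : R) :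
  (forall l, (l < k)%N -> \sum_(i < c) F (l * c + i)%N <= M) ->
  \sum_(i < k * c) F i <= k%:R * M.
Proof.
elim: k => [|k IHk] FM; first by rewrite mul0n big_ord0 mul0r.
rewrite mulSnr big_split_ord /= mulrSr mulrDl mul1r lerD ?FM //.
by apply: IHk => l lk; apply/FM/ltnW.
Qed.

Theorem corollary3p3 (R : realType) (n b d : nat)
    (n_gt0 : (0 < n)%N) (b_gt0 : (0 < b)%N) (d_eq : d = (n * b)%N)
    (X : 'rV[R]_d) :
  forall k b' : nat, (0 < k)%N -> (0 < b')%N -> b = (k * b')%N ->
    Z b X <= Num.sqrt k%:R * Z b' X.
Proof.
move=> k b' k_gt0 b'_gt0 b_eq.
have Z'_ge0 : 0 <= Z b' X by exact: bigmax_ge_id.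
apply: bigmax_le => [|j _]; first by rewrite mulr_ge0 ?sqrtr_ge0.
rewrite sqrt_delta_normE // ler_pdivrMr ?sqrtr_gt0 ?ltr0n //.
(* Since [b = k * b'], the root of [b] supplies a second root of [k]; the factor [k] then counts the
   sub-blocks. *)
have -> : Num.sqrt k%:R * Z b' X * Num.sqrt b%:R
          = k%:R * (Num.sqrt b'%:R * Z b' X) :> R.
  rewrite b_eq natrM sqrtrM ?ler0n // mulrAC !mulrA -expr2.
  by rewrite sqr_sqrtr ?ler0n.
(* Extending the absolute values by 0 to all of [nat] lets blocks of both sizes be sums of one
   sequence, without casts between ordinals. *)
pose F m : R := if insub m is Some i then `|X 0 i| else 0.
have FE c (j' : 'I_(d %/ c)) :
    norm1 (block X j') = \sum_(i < c) F (j' * c + i)%N.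
  apply: eq_bigr => i _; rewrite mxE.
  by rewrite -[(j' * c + i)%N]/(val (block_index j' i)) /F valK.
rewrite FE; case: j => j /= j_lt; rewrite [in X in X <= _]b_eq.
apply: (sum_blocks_le _ k b' (fun i => F (j * (k * b') + i)%N)) => l lk.
(* Sub-block [l] of block [j] is block [j * k + l] of the finer partition, which has [n * k]
   blocks. *)
have jl_lt : (j * k + l < d %/ b')%N.
  rewrite d_eq b_eq mulnA mulnK //.
  have jn : (j < n)%N by move: j_lt; rewrite d_eq mulnK.
  apply: leq_trans (_ : j.+1 * k <= _)%N; last by rewrite leq_mul2r jn orbT.
  by rewrite mulSn addnC ltn_add2r.
have := norm1_block_le _ _ _ X (Ordinal jl_lt) b'_gt0; rewrite FE /=.
by under eq_bigr do rewrite mulnDl -mulnA -addnA.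
Qed.
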